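(* For every graph $G$ and every integer $r\geq 4$, if $d := 2\lceil\log_{r-2} \pi(G)\rceil+1$ then $\pi(G^{(d)})\leq r+2$.
   Context: All graphs are finite, simple and undirected. A path in a graph is a sequence of pairwise distinct vertices, consecutive ones adjacent. Given a vertex colouring $\phi$, a sequence $(v_1,\dots,v_{2s})$ is repetitively coloured if $\phi(v_i)=\phi(v_{s+i})$ for all $i\in\{1,\dots,s\}$; a colouring is nonrepetitive if no path is repetitively coloured. $\pi(G)$ is the minimum number of colours in a nonrepetitive colouring of $G$. For an integer $d\ge 0$, $G^{(d)}$ denotes the $d$-subdivision of $G$: each edge $vw$ is replaced by a path from $v$ to $w$ with exactly $d$ internal vertices, these paths being internally disjoint. *)

(* Defs.v *)
From HB Require Import structures.
From mathcomp Require Import all_boot.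

Set Implicit Arguments.
Unset Strict Implicit.
Unset Printing Implicit Defensive.

Record sgraph := SGraph {
  vertex :> finType;
  adj : rel vertex;
  adj_sym : symmetric adj;
  adj_irrefl : irreflexive adj
}.

Section Nonrepetitive.
Variable G : sgraph.

Definition is_path (p : seq G) : bool := uniq p && sorted (@adj G) p.

(* The two halves of p receive the same colours in order; p must be nonempty,
   i.e. s >= 1 in (v_1, ..., v_2s). *)
Definition repetitive (C : eqType) (phi : G -> C) (p : seq G) : bool :=
  let s := (size p)./2 in
  [&& 0 < size p, ~~ odd (size p) & map phi (take s p) == map phi (drop s p)].

Lemma repetitiveP (C : eqType) (phi : G -> C) (p : seq G) :
  reflect (exists s, [/\ 0 < s, size p = s.*2 &
             forall x0 i, i < s -> phi (nth x0 p i) = phi (nth x0 p (s + i))])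
          (repetitive phi p).
Proof.
apply: (iffP and3P) => [[p0 ev /eqP eq_h]|[s [s0 sz eq_h]]].
  have sz : size p = (size p)./2.*2.
    by rewrite -[LHS]odd_double_half (negbTE ev).
  exists (size p)./2; split => //; first by rewrite -double_gt0 -sz.
  move=> x0 i lt_i; have := congr1 (fun t => nth (phi x0) t i) eq_h.
  rewrite /= !(nth_map x0) ?nth_take ?nth_drop //.
    by rewrite size_drop {1}sz -addnn addnK.
  by rewrite size_takel // {2}sz -addnn leq_addr.
have hs : (size p)./2 = s by rewrite sz doubleK.
rewrite hs sz odd_double double_gt0; split=> //.
case: p sz eq_h {hs} => [|x0 p']; first by case: s s0.
set p := x0 :: p' => sz eq_h.
have st : size (take s p) = s by rewrite size_takel // sz -addnn leq_addr.
have sd : size (drop s p) = s by rewrite size_drop sz -addnn addnK.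
apply/eqP/(@eq_from_nth _ (phi x0)); first by rewrite !size_map st sd.
move=> i; rewrite size_map st => lt_i.
by rewrite !(nth_map x0) ?st ?sd // nth_take // nth_drop; apply: eq_h.
Qed.

(* A path has at most #|G| vertices, so that bounding the length of p, which
   makes the predicate boolean, loses nothing: see nonrepetitiveP. *)
Definition nonrepetitive (C : eqType) (phi : G -> C) : bool :=
  [forall p : #|G|.-bseq G, is_path p ==> ~~ repetitive phi p].

Lemma nonrepetitiveP (C : eqType) (phi : G -> C) :
  reflect (forall p : seq G, is_path p -> ~~ repetitive phi p)
          (nonrepetitive phi).
Proof.
apply: (iffP forallP) => [nr p pp|nr p]; last exact/implyP/nr.
have sz : size p <= #|G|.
  by case/andP: pp => /card_uniqP <- _; apply: max_card.
by have /implyP := nr (Bseq sz); apply.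
Qed.

Definition nonrep_colourable (k : nat) : bool :=
  [exists phi : {ffun G -> 'I_k}, nonrepetitive phi].

Lemma ex_nonrep_colourable : exists k, nonrep_colourable k.
Proof.
exists #|G|; apply/existsP; exists [ffun x => enum_rank x].
apply/nonrepetitiveP => p /andP[up _].
apply/negP => /repetitiveP[s [s0 sz eq_h]].
have [x0 _] : {x0 : G | x0 \in p}.
  by case: p sz {up eq_h} => [|x p]; [case: s s0 | exists x; rewrite mem_head].
have := eq_h x0 0 s0; rewrite !ffunE => /enum_rank_inj/eqP.
rewrite addn0 nth_uniq ?sz ?double_gt0 //; last by rewrite -addnn -ltn_subLR ?subnn.
by rewrite eq_sym -leqn0 leqNgt s0.
Qed.

Definition nonrep_number : nat := ex_minn ex_nonrep_colourable.

End Nonrepetitive.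

Section Subdivision.
Variables (G : sgraph) (d : nat).

(* Each undirected edge uv is represented once, as the ordered pair whose first
   component comes first in the enumeration of the vertices. *)
Definition oriented_edge (uv : G * G) : bool :=
  adj uv.1 uv.2 && (enum_rank uv.1 < enum_rank uv.2).

Definition edge : finType := {uv : G * G | oriented_edge uv}.

(* (uv, i) is the (i+1)-st internal vertex of the path replacing uv, counted
   from u. *)
Definition subdiv_vertex : finType := (G + edge * 'I_d)%type.

(* The vertex in position i, 0 <= i <= d + 1, of the path replacing uv:
   u at 0, v at d + 1, and the internal vertices in between. *)
Definition subdiv_node (uv : edge) (i : nat) : subdiv_vertex :=
  if i is j.+1 then
    if insub j is Some k then inr (uv, k) else inl (val uv).2
  else inl (val uv).1.

Definition subdiv_step (x y : subdiv_vertex) : bool :=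
  [exists uv : edge, exists i : 'I_d.+1,
    (x == subdiv_node uv i) && (y == subdiv_node uv i.+1)].

Definition subdiv_adj : rel subdiv_vertex :=
  [rel x y | subdiv_step x y || subdiv_step y x].

Lemma subdiv_adj_sym : symmetric subdiv_adj.
Proof. by move=> x y; rewrite /subdiv_adj /= orbC. Qed.

Lemma subdiv_adj_irrefl : irreflexive subdiv_adj.
Proof.
move=> x; rewrite /subdiv_adj /= orbb; apply/existsP => -[uv /existsP[i /andP[/eqP-> /eqP]]].
case: i => -[|i] /= lt_i; case: insubP => [k _ Ek|] //.
- case: uv => -[u v] /= /andP[/= uv _] _ [Euv].
  by rewrite Euv adj_irrefl in uv.
- case: insubP => [l _ El|] // [Elk].
  by move: Ek; rewrite Elk El => /eqP; rewrite gtn_eqF.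
- by move/negP; case.
Qed.

Definition subdivision : sgraph := SGraph subdiv_adj_sym subdiv_adj_irrefl.

End Subdivision.

(* Main.v *)
(** Rosenfeld's counting argument gives at least (r - 2)^t square-free words of
    length t over r >= 4 letters, so the colours of an optimal nonrepetitive
    colouring phi of G can be encoded injectively by such words W. With
    d = 2t + 1, colour each path replacing an edge uv by

      A, W(phi u), B, reverse of W(phi v), A,

    where A and B are new colours. Along a path of the subdivision, the distance
    to the closest original vertex is a triangular wave of half-period t + 1
    with A at its minima and B at its maxima. A repetition avoiding A and B is a
    square inside some W(c). In any other repetition the two halves are shifted
    by a multiple of the full period, so each original vertex of the first half
    is matched with one of the second half carrying the same word; the original
    vertices then form a repetitively coloured path of G. *)

Require Import Defs.
From mathcomp Require Import all_boot zify.
Set Implicit Arguments.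
Unset Strict Implicit.
Unset Printing Implicit Defensive.

(** * Square-free words *)

Section SquareFree.
Variable T : eqType.
Implicit Types w : seq T.

Definition prefix_square w s : bool :=
  (s.*2 <= size w) && (take s w == take s (drop s w)).

(** Squares are sought only at the front of each suffix, so that prepending a letter to a
    square-free word can spoil it only through a prefix. *)
Fixpoint sqfree w : bool :=
  if w is _ :: w' then
    sqfree w' && ~~ has (prefix_square w) (iota 1 (size w))
  else true.

Lemma sqfree_drop k w : sqfree w -> sqfree (drop k w).
Proof.
elim: w k => [|a w IHw] [|k] //= /andP[sf_w _].
exact: IHw.
Qed.

Lemma sqfree_onth w i s : sqfree w -> 0 < s -> i + s.*2 <= size w ->
  ~ (forall j, j < s -> onth w (i + j) = onth w (i + s + j)).
Proof.
move=> /(sqfree_drop i) sf_w s_gt0 le_is eq_w.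
have sz_w : s.*2 <= size (drop i w) by rewrite size_drop; lia.
have {}eq_w j : j < s -> onth (drop i w) j = onth (drop i w) (s + j).
  by move=> lt_js; rewrite !onthE map_drop !nth_drop addnA -!onthE; apply: eq_w.
case: (drop i w) sf_w sz_w eq_w => [|a v]; first by move=> _ /=; lia.
move=> /andP[_ /hasPn no_sq] sz_v eq_v.
have /no_sq/negP[] : s \in iota 1 (size (a :: v)) by rewrite mem_iota; lia.
apply/andP; split=> //; apply/eqP/(@eq_from_nth _ a).
  by rewrite !size_takel ?size_drop; lia.
move=> j; rewrite size_takel; last by lia.
move=> lt_js; rewrite !nth_take // nth_drop.
apply: Some_inj; have := eq_v _ lt_js.
by rewrite !onthE !(nth_map a) //; lia.
Qed.

End SquareFree.

(** * Rosenfeld's count of square-free words *)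

Section CountSquareFree.
Variable r : nat.

Definition sqfree_words n : {set n.-tuple 'I_r} :=
  [set w : n.-tuple 'I_r | sqfree w].

Definition num_sqfree n := #|sqfree_words n|.

(* A word a :: w with w square-free that is not square-free is of the form
   u ++ u ++ v, and is determined by |u| and the square-free word u ++ v. *)
Lemma card_sqfree_extensions n :
  r * num_sqfree n <=
  num_sqfree n.+1 + \sum_(s < n.+1) num_sqfree s.
Proof.
pose E := [set [tuple of aw.1 :: tval aw.2] |
             aw in setX [set: 'I_r] (sqfree_words n)].
pose B (s : 'I_n.+1) := [set w in E | prefix_square (tval w) s.+1].
have cardE : #|E| = r * num_sqfree n.
  rewrite card_imset; first by rewrite cardsX cardsT card_ord.
  move=> [a v] [b w] /(congr1 val) /= [-> /val_inj ->]; reflexivity.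
have cardB s : #|B s| <= num_sqfree (rev_ord s).
  rewrite -(card_in_imset (f := @drop_tuple n.+1 s.+1 'I_r)).
    apply: subset_leq_card; apply/subsetP => _ /imsetP[w wB ->].
    move: wB; rewrite !inE => /andP[/imsetP[[a v]]].
    rewrite !inE /= => sf_v -> _ /=.
    exact: sqfree_drop.
  move=> v w; rewrite !inE => /andP[_ /andP[_ /eqP pv]] /andP[_ /andP[_ /eqP pw]].
  move=> /(congr1 val) /= eq_d; apply: val_inj => /=.
  by rewrite -(cat_take_drop s.+1 (val v)) -(cat_take_drop s.+1 (val w)) pv pw eq_d.
rewrite -{}cardE (reindex_inj rev_ord_inj) /=.
apply: (@leq_trans (num_sqfree n.+1 + \sum_s #|B s|)); last first.
  by rewrite leq_add2l; apply: leq_sum => s _; apply: cardB.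
have: E \subset sqfree_words n.+1 :|: \bigcup_s B s.
  apply/subsetP => w wE; rewrite !inE; case: (boolP (sqfree w)) => //= nsf.
  case/imsetP: (wE) nsf => [[a v]]; rewrite !inE /= => sf_v ->.
  move=> nsf; have /hasP[s] : has (prefix_square (a :: v)) (iota 1 n.+1).
    rewrite -[n in iota 1 n.+1](size_tuple v).
    by apply: contraR nsf => no_sq; apply/andP; split.
  rewrite mem_iota => /andP[s_gt0 lt_s] sq.
  have lt_s' : s.-1 < n.+1 by lia.
  apply/bigcupP; exists (Ordinal lt_s') => //; rewrite inE; apply/andP; split.
    by apply/imsetP; exists (a, v) => //; rewrite !inE.
  by rewrite /= prednK.
move/subset_leq_card/leq_trans; apply.
apply: (leq_trans (leq_card_setU _ _).1); rewrite leq_add2l.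
elim/big_rec2: _ => [|s k A _ IH]; first by rewrite cards0.
by apply: (leq_trans (leq_card_setU _ _).1); rewrite leq_add2l.
Qed.

Hypothesis r_ge4 : 4 <= r.

(** With a_n words of length n, the induction hypothesis turns the extension bound into a_(n+1) >=
    (r - 2) a_n >= 2 a_n, the last step by r >= 4. Hence 2 a_n + a_(n+1) <= 2 a_(n+1). *)
Lemma sum_card_sqfree n :
  \sum_(s < n.+1) num_sqfree s <= 2 * num_sqfree n.
Proof.
elim: n => [|n IHn]; first by rewrite big_ord_recr big_ord0 /=; lia.
rewrite big_ord_recr /=; apply: leq_trans (leq_add IHn (leqnn _)) _.
have := leq_trans (card_sqfree_extensions n) (leq_add (leqnn _) IHn).
by have := leq_mul r_ge4 (leqnn (num_sqfree n)); lia.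
Qed.

Lemma card_sqfree_words n : (r - 2) ^ n <= #|sqfree_words n|.
Proof.
rewrite -/(num_sqfree n); elim: n => [|n IHn].
  rewrite expn0 card_gt0; apply/set0Pn; exists [tuple].
  by rewrite inE.
have := leq_trans (card_sqfree_extensions n) (leq_add (leqnn _) (sum_card_sqfree n)).
by have := leq_mul (leqnn (r - 2)) IHn; rewrite expnS mulnBl; lia.
Qed.

End CountSquareFree.

(** * Triangular waves: for n > 0, [tri n m] is the distance from m to the nearest multiple of 2n *)

Definition tri n m := minn (m %% n.*2) (n.*2 - m %% n.*2).

Section Tri.
Variable n : nat.
Hypothesis n_gt0 : 0 < n.

Lemma tri_add e q : e <= n -> tri n (q * n.*2 + e) = e.
Proof. by move=> le_en; rewrite /tri modnMDl modn_small; lia. Qed.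

Lemma tri_sub e q : 0 < q -> e <= n -> tri n (q * n.*2 - e) = e.
Proof.
case: q e => // q [|e] _ le_en; first by rewrite subn0 -[_ * _]addn0 tri_add.
rewrite /tri (_ : _ - _ = q * n.*2 + (n.*2 - e.+1)) ?modnMDl ?modn_small; lia.
Qed.

Lemma modn_succ d m : 0 < d ->
  m.+1 %% d = if (m %% d).+1 == d then 0 else (m %% d).+1.
Proof.
move=> d_gt0; rewrite -addn1 -modnDml addn1.
have := ltn_pmod m d_gt0; case: eqP => [->|ne] lt_md; first by rewrite modnn.
by rewrite modn_small //; lia.
Qed.

Lemma tri_step m : tri n m.+1 = (tri n m).+1 \/ tri n m = (tri n m.+1).+1.
Proof.
rewrite /tri modn_succ; last by lia.
by have := @ltn_pmod m n.*2; case: ifP; lia.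
Qed.

Lemma tri_no_turn m : 0 < tri n m.+1 < n -> tri n m != tri n m.+2.
Proof.
rewrite /tri !(modn_succ _ (d := n.*2)); try lia.
have := @ltn_pmod m n.*2; case: ifP => ?; case: ifP; lia.
Qed.

(** Each of the extreme values 0 and n is taken exactly once per period. *)
Lemma tri_turn_dvd m s :
  tri n m = tri n (m + s) -> (tri n m == 0) || (tri n m == n) -> n.*2 %| s.
Proof.
have := @ltn_pmod m n.*2; have := @ltn_pmod (m + s) n.*2.
rewrite /tri => ? ? ? ?.
have : m + s == m + 0 %[mod n.*2] by rewrite addn0; apply/eqP; lia.
by rewrite eqn_modDl mod0n.
Qed.

(** The first two values determine the rest: strictly between 0 and n the direction persists, and at
    0 or n the bounds force a turn. The phase [c] only has to fit those two values. *)
Lemma zigzag_tri N (f : nat -> nat) : 1 < N ->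
  (forall i, i < N -> f i <= n) ->
  (forall i, i.+1 < N -> f i.+1 = (f i).+1 \/ f i = (f i.+1).+1) ->
  (forall i, i.+2 < N -> 0 < f i.+1 < n -> f i != f i.+2) ->
  exists2 c, 0 < c <= n.*2 & forall i, i < N -> f i = tri n (c + i).
Proof.
move=> N_gt1 le_fn f_step f_turn.
have [c c_in [f0 f1]] : exists2 c, 0 < c <= n.*2 &
    f 0 = tri n c /\ f 1 = tri n c.+1.
  have le0 := le_fn 0 (ltnW N_gt1); have le1 := le_fn 1 N_gt1.
  case: (f_step 0 N_gt1) => E.
    (* A rising start has phase f 0, except that 0 is replaced by a full period to keep [c]
       positive. *)
    exists (if f 0 is 0 then n.*2 else f 0); first by case: (f 0) le0; lia.
    case E0: (f 0) E le0 => [|k] E le0; split.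
    - by have := @tri_add 0 1; rewrite mul1n addn0 => ->.
    - by have := @tri_add 1 1; rewrite mul1n addn1 => ->; lia.
    - by have := @tri_add k.+1 0; rewrite mul0n add0n => ->; lia.
    - by have := @tri_add k.+2 0; rewrite mul0n add0n => ->; lia.
  exists (n.*2 - f 0); first by lia.
  split; first by have := @tri_sub (f 0) 1; rewrite mul1n => ->.
  by have := @tri_sub (f 1) 1; rewrite mul1n E subnSK => [->|]; lia.
exists c => // i.
(* Two consecutive values are carried through the induction, since the next one depends on the
   direction. *)
suff [//] : (i < N -> f i = tri n (c + i)) /\ (i.+1 < N -> f i.+1 = tri n (c + i.+1)).
elim: i => [|i [IH1 IH2]]; first by rewrite addn0 addn1.
split=> // lt_iN; have Ei := IH1 (ltnW (ltnW lt_iN)); have Ei1 := IH2 (ltnW lt_iN).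
have := le_fn _ (ltnW lt_iN); have := le_fn _ lt_iN; have := f_step _ lt_iN.
have := f_turn _ lt_iN; have := @tri_no_turn (c + i); have := tri_step (c + i).+1.
have := tri_step (c + i).
have : tri n (c + i).+2 <= n by rewrite /tri; lia.
rewrite Ei Ei1 !addnS; lia.
Qed.

End Tri.

(** * Heights and nearest original vertices along paths of the subdivision *)

Section SubdivisionPaths.
Variables (G : sgraph) (d n : nat).
Hypothesis dn : d.+1 = n.*2.
Local Notation H := (subdivision G d).
Implicit Types (x y z : H) (uv : edge G).

(** Distance to the closest original vertex: index [k] is position k + 1 of d + 1, hence at distance
    d - k from the far end. *)
Definition height x : nat :=
  match x with inl _ => 0 | inr (_, k) => minn k.+1 (d - k) end.

(* The middle vertex of the path replacing uv is arbitrarily attached to v. *)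
Definition nearest x : G :=
  match x with
  | inl v => v
  | inr (uv, k) => if k.+1 < n then (val uv).1 else (val uv).2
  end.

Lemma height_node uv i :
  i <= d.+1 -> height (subdiv_node d uv i) = minn i (d.+1 - i).
Proof.
case: i => [|i] le_i //=; case: insubP => [k _ /= ->|] /=; lia.
Qed.

Lemma nearest_node uv i : i <= d.+1 ->
  nearest (subdiv_node d uv i) = if i < n then (val uv).1 else (val uv).2.
Proof.
case: i => [|i] le_i /=; first by rewrite (_ : 0 < n) //; lia.
case: insubP => [k _ /= ->|] //=.
by case: ifP => //; lia.
Qed.

Lemma height_le x : height x <= n.
Proof. by case: x => //= -[uv k]; have := ltn_ord k; lia. Qed.

Lemma height0 x : height x = 0 -> x = inl (nearest x).
Proof. by case: x => //= -[uv k] /=; have := ltn_ord k; lia. Qed.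

Lemma adj_nodes x y : adj x y -> exists uv i, i <= d /\
  ((x = subdiv_node d uv i /\ y = subdiv_node d uv i.+1) \/
   (y = subdiv_node d uv i /\ x = subdiv_node d uv i.+1)).
Proof.
case/orP => /existsP[uv /existsP[i /andP[/eqP E1 /eqP E2]]];
  exists uv, i; split; by [have := ltn_ord i; lia | left | right].
Qed.

Lemma subdiv_node_inr uv i uv' (k : 'I_d) :
  subdiv_node d uv i = inr (uv', k) -> uv = uv' /\ i = k.+1.
Proof.
case: i => [|i] //=; case: insubP => [l _ /= <-|] //.
by case=> -> ->.
Qed.

Lemma adj_internal uv (k : 'I_d) x : adj (inr (uv, k) : H) x ->
  x = subdiv_node d uv k \/ x = subdiv_node d uv k.+2.
Proof.
case/adj_nodes => [uv' [i [_ [[/esym/subdiv_node_inr[-> ->] ->]|]]]].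
  by right.
by case=> -> /esym/subdiv_node_inr[-> [->]]; left.
Qed.

Lemma height_adj x y :
  adj x y -> height y = (height x).+1 \/ height x = (height y).+1.
Proof.
case/adj_nodes => [uv [i [le_id [[-> ->]|[-> ->]]]]];
  rewrite !height_node; lia.
Qed.

(** The nearest original vertex can change only at a middle vertex, whose height is n. *)
Lemma nearest_adj x y :
  adj x y -> height x < n -> height y < n -> nearest x = nearest y.
Proof.
case/adj_nodes => [uv [i [le_id [[-> ->]|[-> ->]]]]];
  rewrite !height_node ?nearest_node; try lia;
  by move=> ? ?; case: ifP => ?; case: ifP => ? //; lia.
Qed.

(** An internal vertex has just two neighbours, one on each side; away from the middle one of them
    is higher and the other lower. *)
Lemma height_no_turn x y z : adj y x -> adj y z -> x != z ->
  0 < height y < n -> height x != height z.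
Proof.
case: y => // -[uv k] /adj_internal xE /adj_internal zE.
have := ltn_ord k => lt_k.
case: xE zE => -> [] ->; rewrite ?eqxx // => _; rewrite !height_node /=; lia.
Qed.

Lemma adj_edge uv : adj (val uv).1 (val uv).2.
Proof. by case: uv => uv /= /andP[]. Qed.

(** The two neighbours of a middle vertex lie in opposite halves of the path replacing an edge, so
    their nearest vertices are the two ends of that edge. *)
Lemma nearest_middle x y z : adj y x -> adj y z -> x != z ->
  height y = n -> adj (nearest x) (nearest z).
Proof.
case: y => [v _ _ _ /= n0|]; first by move: dn; rewrite -n0.
case=> uv k /adj_internal xE /adj_internal zE.
have := ltn_ord k => lt_k; have euv := adj_edge uv.
case: xE zE => -> [] ->; rewrite ?eqxx // => _ hn;
  rewrite !nearest_node /= in hn *; try lia.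
  by case: ifP => [_|?]; [case: ifP => // ?; lia | lia].
by case: ifP => [?|_]; [lia | case: ifP => [_|?]; [rewrite adj_sym | lia]].
Qed.

Section Path.
Variables (N : nat) (x : nat -> H).
Hypothesis x_adj : forall i, i.+1 < N -> adj (x i) (x i.+1).
Hypothesis x_inj : forall i j, i < N -> j < N -> x i = x j -> i = j.

Lemma path_height_tri : 1 < N ->
  exists2 c, 0 < c <= n.*2 & forall i, i < N -> height (x i) = tri n (c + i).
Proof.
move=> N_gt1; apply: zigzag_tri => //; first by lia.
- by move=> i _; apply: height_le.
- by move=> i lt_i; apply: height_adj; apply: x_adj.
- move=> i lt_i; apply: height_no_turn.
  + by rewrite adj_sym; apply: x_adj; lia.
  + exact: x_adj.
  + by apply/eqP => /x_inj; lia.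
Qed.

Lemma path_nearest_const a b : a <= b -> b < N ->
  (forall i, a <= i <= b -> height (x i) < n) -> nearest (x a) = nearest (x b).
Proof.
elim: b => [|b IHb]; first by rewrite leqn0 => /eqP->.
rewrite leq_eqVlt => /orP[/eqP-> //|le_ab] lt_b h_lt.
rewrite IHb; try lia; last by move=> i ?; apply: h_lt; lia.
by apply: nearest_adj; [apply: x_adj | apply: h_lt; lia | apply: h_lt; lia].
Qed.

Lemma path_nearest_middle i : i.+2 < N -> height (x i.+1) = n ->
  adj (nearest (x i)) (nearest (x i.+2)).
Proof.
move=> lt_i; apply: nearest_middle.
- by rewrite adj_sym; apply: x_adj; lia.
- exact: x_adj.
- by apply/eqP => /x_inj; lia.
Qed.

End Path.

End SubdivisionPaths.

(** * The colouring of the subdivision and its nonrepetitiveness *)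

Section SubdivisionColouring.
Variables (G : sgraph) (d t : nat) (C K : eqType).
Variables (phi : G -> C) (W : C -> t.-tuple K).
Hypothesis dt : d.+1 = t.+1.*2.
Hypothesis W_inj : injective W.
Hypothesis W_sqfree : forall c, sqfree (W c).
Hypothesis phi_nonrep : nonrepetitive phi.
Local Notation H := (subdivision G d).
Local Notation near := (nearest t.+1).

(* At height t + 1, onth overflows, so that middle vertices get Some None. *)
Definition subdiv_colour (x : H) : option (option K) :=
  if height x is k.+1 then Some (onth (W (phi (near x))) k) else None.

Lemma subdiv_colourS x k : height x = k.+1 ->
  subdiv_colour x = Some (onth (W (phi (near x))) k).
Proof. by rewrite /subdiv_colour => ->. Qed.

(** [None] occurs only at height 0, and [Some None] only at height t + 1 because every word has
    length exactly t. *)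
Lemma subdiv_colour_turn x y : subdiv_colour x = subdiv_colour y ->
  (height x == 0) || (height x == t.+1) -> height y = height x.
Proof.
have := height_le dt y; rewrite /subdiv_colour => le_y eq_c.
case/orP => /eqP hx; move: eq_c; rewrite hx; first by case: (height y).
rewrite onth_default ?size_tuple //; case: (height y) le_y => // k le_y [].
move=> eq_c; have := onthNE (W (phi (near y))) k.
by rewrite -eq_c size_tuple /=; lia.
Qed.

Section RepetitivePath.
Variables (s c : nat) (x : nat -> H).
Hypothesis s_gt0 : 0 < s.
Hypothesis x_adj : forall i, i.+1 < s.*2 -> adj (x i) (x i.+1).
Hypothesis x_inj : forall i j, i < s.*2 -> j < s.*2 -> x i = x j -> i = j.
Hypothesis x_col :
  forall i, i < s -> subdiv_colour (x i) = subdiv_colour (x (s + i)).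
Hypothesis c_bounds : 0 < c <= t.+1.*2.
Hypothesis x_height : forall i, i < s.*2 -> height (x i) = tri t.+1 (c + i).

(** Such a path is monotone in height and keeps one nearest vertex, so it spells a factor of a
    single word, forwards or backwards; a repetition would be a square in it. *)
Lemma no_repetition_between_turns :
  (forall i, i < s.*2 -> 0 < height (x i) < t.+1) -> False.
Proof.
move=> h_in.
have near_x i : i < s.*2 -> near (x i) = near (x 0).
  move=> lt_i; apply/esym/(path_nearest_const dt x_adj) => // j ?.
  by have := h_in j; lia.
have col_x i k l : i < s -> height (x i) = k.+1 -> height (x (s + i)) = l.+1 ->
    onth (W (phi (near (x 0)))) k = onth (W (phi (near (x 0)))) l.
  move=> lt_i hk hl; have := x_col lt_i.
  by rewrite (subdiv_colourS hk) (subdiv_colourS hl) !near_x; [case | lia..].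
have sz : size (W (phi (near (x 0)))) = t by rewrite size_tuple.
(* The wave rises when c < t + 1 and falls when c > t + 1; the path must end before the next
   turn. *)
have [lt_c|ge_c] := ltnP c t.+1.
  have lt_end : c + s.*2 <= t.+1.
    rewrite leqNgt; apply/negP => lt_end.
    have lt_i : t.+1 - c < s.*2 by lia.
    have := h_in _ lt_i; rewrite x_height // subnKC ?(ltnW lt_c) //.
    by have := @tri_add t.+1 isT t.+1 0; rewrite mul0n add0n => ->; lia.
  have h_x i : i < s.*2 -> height (x i) = (c.-1 + i).+1.
    move=> lt_i; rewrite x_height //.
    by have := @tri_add t.+1 isT (c + i) 0; rewrite mul0n add0n => ->; lia.
  apply: (@sqfree_onth _ (W (phi (near (x 0)))) c.-1 s) => //; first by lia.
  move=> j lt_js; apply: (col_x j) => //; first by rewrite h_x; lia.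
  by rewrite h_x; lia.
have ne_c : c <> t.+1.
  move=> cE; have s2_gt0 : 0 < s.*2 by lia.
  have := h_in 0 s2_gt0; rewrite x_height // addn0 cE.
  by have := @tri_add t.+1 isT t.+1 0; rewrite mul0n add0n => ->; lia.
have lt_end : c + s.*2 <= t.+1.*2.
  rewrite leqNgt; apply/negP => lt_end.
  have lt_i : t.+1.*2 - c < s.*2 by lia.
  have := h_in _ lt_i; rewrite x_height // subnKC; last by lia.
  by have := @tri_add t.+1 isT 0 1; rewrite mul1n addn0 => ->.
have h_x i : i < s.*2 -> height (x i) = (t.+1.*2 - c - i.+1).+1.
  move=> lt_i; rewrite x_height //.
  have := @tri_sub t.+1 isT (t.+1.*2 - (c + i)) 1 isT.
  by rewrite mul1n subKn => [->|]; lia.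
(* The word is read backwards: the square starts at the letter of the last vertex, and offset j
   corresponds to position s - 1 - j within each half. *)
apply: (@sqfree_onth _ (W (phi (near (x 0)))) (t.+1.*2 - c - s.*2) s) => //.
  by lia.
move=> j lt_js; apply/esym/(col_x (s.-1 - j)); first by lia.
  by rewrite h_x; lia.
by rewrite h_x; lia.
Qed.

(** The matched turn makes s = m periods, so the path meets 2m original vertices; these form a path
    of [G] in which the k-th and (m + k)-th agree in colour. *)
Lemma no_repetition_through_turn i0 :
  i0 < s -> (height (x i0) == 0) || (height (x i0) == t.+1) -> False.
Proof.
move=> lt_i0 turn.
have /dvdnP[m sE] : t.+1.*2 %| s.
  apply: (@tri_turn_dvd t.+1 isT (c + i0)); last by rewrite -x_height //; lia.
  rewrite -addnA -!x_height; try lia.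
  by rewrite [i0 + s]addnC (subdiv_colour_turn (x_col lt_i0) turn).
(* [pos k] is the index of the k-th original vertex, where the wave argument is (k + 1) D. As 0 < c
   <= D, the first is not missed and all 2m lie on the path. *)
pose D := t.+1.*2; pose pos k := D - c + k * D; pose v k := near (x (pos k)).
have mulD_le k l : k < l -> k * D + D <= l * D.
  by move=> lt_kl; rewrite -mulSnr leq_mul2r lt_kl orbT.
have sE2 : s.*2 = m.*2 * D by rewrite sE doubleMl.
have m_gt0 : 0 < m by case: m sE {sE2} => //; lia.
have pos_lt k : k < m.*2 -> pos k < s.*2.
  by move=> /mulD_le; rewrite -sE2 /pos /D; lia.
have pos_c k : c + pos k = k.+1 * D by rewrite /pos mulSn; lia.
have h_up k e : e <= t.+1 -> pos k + e < s.*2 -> height (x (pos k + e)) = e.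
  by move=> le_e lt_s; rewrite x_height // addnA pos_c tri_add.
have h_dn k e : e <= t.+1 -> e <= pos k -> pos k < s.*2 ->
    height (x (pos k - e)) = e.
  move=> le_e le_ek lt_s; rewrite x_height; last by lia.
  by rewrite addnBA // pos_c tri_sub.
have near_up k e : e <= t -> pos k + e < s.*2 -> near (x (pos k + e)) = v k.
  move=> le_e lt_s; apply/esym/(path_nearest_const dt x_adj) => //; first by lia.
  move=> i le_i; rewrite -(subnKC (m := pos k) (n := i)) ?h_up; lia.
have near_dn k e : e <= t -> e <= pos k -> pos k < s.*2 ->
    near (x (pos k - e)) = v k.
  move=> le_e le_ek lt_s; apply/(path_nearest_const dt x_adj) => //; first by lia.
  move=> i le_i; rewrite -(subKn (m := i) (n := pos k)) ?h_dn; lia.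
have v_adj k : k.+1 < m.*2 -> adj (v k) (v k.+1).
  move=> lt_k; have posS : pos k.+1 = pos k + D by rewrite /pos mulSn; lia.
  have := pos_lt _ lt_k; rewrite posS => lt_s.
  (* Between [v k] and [v k.+1] lies one middle vertex, at index pos k + t + 1; its two neighbours
     on the path are near [v k] and [v k.+1]. *)
  rewrite -(near_up k t) //; last by lia.
  rewrite -(near_dn k.+1 t) ?posS //; try (by rewrite /D; lia).
  rewrite (_ : pos k + D - t = (pos k + t).+2); last by rewrite /D; lia.
  apply: (path_nearest_middle dt x_adj x_inj); first by rewrite /D in lt_s; lia.
  by rewrite -addnS h_up //; rewrite /D in lt_s; lia.
have v_inj k l : k < m.*2 -> l < m.*2 -> v k = v l -> k = l.
  move=> lt_k lt_l eq_v; have lt_pk := pos_lt _ lt_k; have lt_pl := pos_lt _ lt_l.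
  have hk : height (x (pos k)) = 0 by rewrite -[pos k]addn0 h_up // addn0.
  have hl : height (x (pos l)) = 0 by rewrite -[pos l]addn0 h_up // addn0.
  have := x_inj lt_pk lt_pl; rewrite (height0 dt hk) (height0 dt hl).
  rewrite -/(v k) -/(v l) eq_v => /(_ erefl)/eqP.
  by rewrite eqn_add2l eqn_pmul2r // => /eqP.
have v_col k : k < m -> phi (v k) = phi (v (m + k)).
  move=> lt_k; apply: W_inj; apply: val_inj; apply: eq_from_onth_le => e.
  rewrite !size_tuple maxnn => lt_e.
  have posD : pos (m + k) = s + pos k by rewrite /pos mulnDl -sE; lia.
  have := mulD_le _ _ lt_k; rewrite -sE => le_kD.
  (* The first half contains all t letters on at least one side of its k-th original vertex: after
     it if c > t + 1, before it otherwise. Injectivity of [W] then recovers the colour. *)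
  have [lt_c|ge_c] := ltnP t.+1 c.
    have lt_s : pos k + e.+1 < s by rewrite /pos /D in le_kD *; lia.
    have lt_s2 : pos (m + k) + e.+1 < s.*2 by rewrite posD; lia.
    have := x_col lt_s; rewrite addnA -posD.
    rewrite (@subdiv_colourS _ e) ?(@subdiv_colourS (x (_ + _)) e) ?h_up ?near_up //; try lia.
    by case.
  have le_p : e.+1 <= pos k by rewrite /pos /D; lia.
  have lt_s : pos k < s by rewrite /pos /D in le_kD *; lia.
  have lt_s1 : pos k - e.+1 < s by lia.
  have := x_col lt_s1; rewrite addnBA // -posD.
  rewrite (@subdiv_colourS _ e) ?(@subdiv_colourS (x (_ - _)) e) ?h_dn ?near_dn //; try lia.
  by case.
have v_path : is_path (mkseq v m.*2).
  apply/andP; split.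
    rewrite map_inj_in_uniq ?iota_uniq // => k l.
    by rewrite !mem_iota /= !add0n; apply: v_inj.
  apply/(sortedP (v 0)) => k; rewrite size_mkseq => lt_k.
  by rewrite !nth_mkseq; [apply: v_adj | lia..].
apply/negP: (nonrepetitiveP _ phi_nonrep _ v_path); rewrite negbK.
apply/repetitiveP; exists m; split=> //; first by rewrite size_mkseq.
by move=> v0 k lt_k; rewrite !nth_mkseq; [apply: v_col | lia..].
Qed.

End RepetitivePath.

Lemma subdiv_colour_nonrep : nonrepetitive subdiv_colour.
Proof.
apply/nonrepetitiveP => p /andP[up sp]; apply/negP => /repetitiveP[s [s_gt0 sz col]].
case: p up sp sz col => [|x0 p]; first by case: s s_gt0.
move: (x0 :: p) => q uq /(sortedP x0) sq sz col.
have x_adj i : i.+1 < s.*2 -> adj (nth x0 q i) (nth x0 q i.+1) by rewrite -sz; apply: sq.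
have x_inj i j : i < s.*2 -> j < s.*2 -> nth x0 q i = nth x0 q j -> i = j.
  by rewrite -sz => lt_i lt_j /eqP; rewrite nth_uniq // => /eqP.
have [|c c_bounds hx] := path_height_tri dt x_adj x_inj; first by lia.
have [/existsP[i turn]|] := boolP [exists i : 'I_s,
    (height (nth x0 q i) == 0) || (height (nth x0 q i) == t.+1)].
  exact: (no_repetition_through_turn s_gt0 x_adj x_inj (col x0) c_bounds hx (ltn_ord i) turn).
rewrite negb_exists => /forallP no_turn.
have h1 i : i < s -> 0 < height (nth x0 q i) < t.+1.
  move=> lt_i; have := height_le dt (nth x0 q i).
  by case/norP: (no_turn (Ordinal lt_i)) => /=; rewrite -lt0n ltn_neqAle; lia.
apply: (no_repetition_between_turns s_gt0 x_adj (col x0) c_bounds hx) => i lt_i.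
have [/h1 //|le_si] := ltnP i s; have lt_is : i - s < s by lia.
(* A turn in the second half would be matched with one in the first. *)
have := col x0 _ lt_is; rewrite subnKC // => /esym/subdiv_colour_turn.
by have := h1 _ lt_is; have := height_le dt (nth x0 q i); lia.
Qed.

End SubdivisionColouring.

(** * From colourings to the nonrepetitive chromatic number *)

Lemma nonrep_number_le (G : sgraph) (C : finType) (phi : G -> C) :
  nonrepetitive phi -> nonrep_number G <= #|C|.
Proof.
move=> /nonrepetitiveP nr; rewrite /nonrep_number; case: ex_minnP => k _; apply.
apply/existsP; exists [ffun x => enum_rank (phi x)].
apply/nonrepetitiveP => p /nr; apply: contraNN => /repetitiveP[s [s0 sz col]].
apply/repetitiveP; exists s; split=> // x0 i lt_i.
by have := col x0 i lt_i; rewrite !ffunE => /enum_rank_inj.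
Qed.

Lemma nonrep_number_colouring (G : sgraph) :
  exists phi : G -> 'I_(nonrep_number G), nonrepetitive phi.
Proof.
rewrite /nonrep_number; case: ex_minnP => k /existsP[phi nr] _.
by exists phi.
Qed.

Theorem theorem92 (G : sgraph) (r : nat) (hr : 4 <= r) :
  let d := 2 * up_log (r - 2) (nonrep_number G) + 1 in
  nonrep_number (subdivision G d) <= r + 2.
Proof.
cbv zeta; set t := up_log (r - 2) (nonrep_number G); set d := 2 * t + 1.
have [phi nr] := nonrep_number_colouring G.
have le_words : nonrep_number G <= #|sqfree_words r t|.
  apply: leq_trans (card_sqfree_words hr t).
  by apply: up_logP; lia.
(* There are enough square-free words of length t to give each colour its own. *)
pose W (i : 'I_(nonrep_number G)) := enum_val (widen_ord le_words i).
have W_inj : injective W.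
  by move=> i j /enum_val_inj/(congr1 val) /= /val_inj.
have W_sqfree i : sqfree (W i).
  by have := enum_valP (widen_ord le_words i); rewrite inE.
have dt : d.+1 = t.+1.*2 by rewrite /d; lia.
have := nonrep_number_le (subdiv_colour_nonrep dt W_inj W_sqfree nr).
(* The palette is [option (option 'I_r)]: r letters and two marks for the turns. *)
by rewrite !card_option card_ord addn2.
Qed.
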